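(* Let $n\ge 1$ be an integer. Let $\mathcal X\subset\mathbb R^2$ be an $n$-independent set of nodes with $\#\mathcal X\le 2n+[n/2]+1$. Then each node of $\mathcal X$ has an $n$-fundamental polynomial (with respect to $\mathcal X$) which is a product of lines and conics. Moreover, this statement is not true in general for larger sets: for every $n\ge 3$ and every integer $s$ with $2n+[n/2]+2\le s\le\binom{n+2}{2}$ there exist an $n$-independent set $\mathcal X\subset\mathbb R^2$ with $\#\mathcal X=s$ and a node $A\in\mathcal X$ such that no $n$-fundamental polynomial of $A$ with respect to $\mathcal X$ is a product of lines and conics.
   Context: $[x]$ denotes the integer part of $x$. $\Pi_n$ denotes the space of real polynomials in two variables of total degree at most $n$; $\dim\Pi_n=\binom{n+2}{2}$. A set of nodes is a finite set $\mathcal X$ of distinct points of $\mathbb R^2$. For $A\in\mathcal X$, an $n$-fundamental polynomial of $A$ (with respect to $\mathcal X$) is a polynomial $p\in\Pi_n$ with $p(A)=1$ and $p(B)=0$ for all $B\in\mathcal X\setminus\{A\}$; a polynomial in $\Pi_n$ that vanishes on $\mathcal X\setminus\{A\}$ and is nonzero at $A$ is also called fundamental, being a nonzero constant multiple of such a $p$. The set $\mathcal X$ is $n$-independent if every node of $\mathcal X$ has an $n$-fundamental polynomial; this forces $\#\mathcal X\le\binom{n+2}{2}$. Lines and conics are identified with real polynomials of degree $1$ and $2$, respectively, defining them (a conic may be reducible); ''a product of lines and conics'' means a product of real polynomials each of degree $1$ or $2$ (factors of only one of the two kinds are allowed), up to a nonzero constant factor. *)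

(* Defs.v *)
From HB Require Import structures.
From mathcomp Require Import all_boot all_order all_algebra.
From mathcomp Require Import finmap mpoly.
From mathcomp Require Import reals.

Set Implicit Arguments.
Unset Strict Implicit.
Unset Printing Implicit Defensive.

Local Open Scope ring_scope.

Section Nodes.
Variable R : realType.

(* Polynomials in two variables over R; a point of the plane is a row vector,
   and [q.@[A 0]] evaluates q at the coordinate function of A. *)
Notation bpoly := {mpoly R[2]}.
Notation point := 'rV[R]_2.

(* [msize q] is the total degree of q plus one, and [msize 0 = 0]. *)
Definition in_Pi (n : nat) (q : bpoly) : Prop := (msize q <= n.+1)%N.

Definition fundamental (n : nat) (X : {fset point}) (A : point) (q : bpoly) :
    Prop :=
  [/\ in_Pi n q, q.@[A 0] = 1 &
      forall B : point, B \in X -> B != A -> q.@[B 0] = 0].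

Definition independent (n : nat) (X : {fset point}) : Prop :=
  forall A : point, A \in X -> exists q : bpoly, fundamental n X A q.

Definition is_line (q : bpoly) : Prop := msize q = 2%N.
Definition is_conic (q : bpoly) : Prop := msize q = 3%N.

(* At least one factor is required, so a nonzero constant alone does not count;
   repeated factors are allowed. *)
Definition product_of_lines_and_conics (q : bpoly) : Prop :=
  exists (c : R) (s : seq bpoly),
    [/\ c != 0, s != [::],
        forall f : bpoly, f \in s -> is_line f \/ is_conic f &
        q = c *: \prod_(f <- s) f].

End Nodes.

(* Main.v *)
Require Import Defs.
From mathcomp Require Import all_boot all_order all_algebra.
From mathcomp Require Import finmap mpoly.
From mathcomp Require Import reals.
From mathcomp Require Import zify.

(** Fix a node A and let Y be the set of the other nodes.  Write n = 2m + e
    with e equal to 0 or 1.  The fundamental polynomial is sought with m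
    factors of degree at most 2 and e factors of degree at most 1, so Y has to
    be split into m + e classes, each lying on a curve of the right degree that
    misses A.  Let h_d(S) be the Hilbert function of a finite set S, that is,
    the rank of the evaluations at S of the polynomials of degree at most d.  A
    class C fits on a curve of degree d missing A as soon as
    h_d(A, C) - 1 >= |C|, which says that C is independent in the matroid with
    rank function h_d(A, .) - 1.  The matroid union theorem ([rank_union],
    proved by the argument of Rado) then turns the problem into one inequality,
      |J| <= m (h_2(A, J) - 1) + e (h_1(A, J) - 1)   for all J included in Y.

    That inequality ([matroid_rank_inequality]) is where independence and the
    bound |Y| <= 2n + m = 5m + 2e enter.  If h_2(A, J) = 6 the right-hand side
    is 5m + 2e.  Otherwise the nodes of J and A lie on a conic, and an
    n-independent set has at most 2n + 1 points on a conic and n + 1 on a line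
    ([hilb_curve]).  The bound for a line suffices when they are collinear, and
    the bound for a conic when they are not and h_2(A, J) = 5.  When h_2(A, J) <= 4 and
    J together with A is not collinear, all of these points except at most one
    lie on a line, or there are at most four of them ([hilb2_le4]).  The latter
    follows from residuation with respect to a line ([hilb_residual]):
    h_2(S) >= h_2(S on the line) + h_1(S off the line).

    For the sharpness, nodes are added one by one, each off finitely many
    curves, so that every set of at most binom(d + 2, 2) of them is
    d-independent for each d <= n ([generic_exists]).  A line then meets at
    most 2 nodes and a conic at most 5, hence a product of lines and conics of
    total degree at most n meets at most 5n/2 nodes, which is less than
    2n + [n/2] + 1. *)

Set Implicit Arguments.
Unset Strict Implicit.
Unset Printing Implicit Defensive.

Import Order.TTheory GRing.Theory Num.Theory.

(** * Matroid union *)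

Section RankUnion.
Variables (T I : finType) (rho : I -> {set T} -> nat).
Hypothesis rho0 : forall i, rho i set0 = 0.
Hypothesis rho_mono : forall i (A B : {set T}), A \subset B -> rho i A <= rho i B.
Hypothesis rho_submod : forall i (A B : {set T}),
  rho i (A :|: B) + rho i (A :&: B) <= rho i A + rho i B.

(** [L y] is the set of slots that are still open to [y].  This is Rado's
    setting for the family of sets [{(i, y) : i in L y}] in the direct sum of
    the matroids. *)
Definition slot_rank (L : {ffun T -> {set I}}) (J : {set T}) :=
  \sum_i rho i [set y in J | i \in L y].

Definition hall L := forall J : {set T}, #|J| <= slot_rank L J.

Definition drop_slot (L : {ffun T -> {set I}}) y0 i0 : {ffun T -> {set I}} :=
  [ffun y => if y == y0 then L y :\ i0 else L y].

Lemma slot_rank_drop_notin L y0 i0 (J : {set T}) :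
  y0 \notin J -> slot_rank (drop_slot L y0 i0) J = slot_rank L J.
Proof.
move=> y0J; apply: eq_bigr => i _; congr (rho i _).
apply/setP => y; rewrite !inE ffunE; case: eqP => // ->.
by rewrite (negbTE y0J).
Qed.

(** Each slot of [y0] survives in one of the two reduced families, because
    [i1 != i2]: so the union of the two sets seen by slot [i] is all of the set
    for [J1 :|: J2], and submodularity applies slot by slot. *)
Lemma slot_rank_drop_submod L y0 i1 i2 (J1 J2 : {set T}) :
  i1 != i2 -> y0 \in J1 -> y0 \in J2 ->
  slot_rank L (J1 :|: J2) + slot_rank L ((J1 :&: J2) :\ y0) <=
  slot_rank (drop_slot L y0 i1) J1 + slot_rank (drop_slot L y0 i2) J2.
Proof.
move=> i12 y1 y2; rewrite -!big_split /=; apply: leq_sum => i _.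
apply: leq_trans (rho_submod i _ _); apply: leq_add; apply: rho_mono;
  apply/subsetP => y; rewrite !inE !ffunE; case: (y =P y0) => [->|_] //=.
- rewrite !inE y1 y2 /= => ->; rewrite !andbT.
  by case: (i =P i1) i12 => // ->.
- by case: (i \in L y); rewrite ?andbF // !andbT.
by case/andP => /andP[-> ->] ->.
Qed.

(** Two sets violating Hall's condition after the two deletions both contain
    [y0], so by submodularity the condition would fail for their union or for
    their intersection without [y0] already before the deletions. *)
Lemma hall_drop L y0 i1 i2 :
  hall L -> i1 != i2 -> hall (drop_slot L y0 i1) \/ hall (drop_slot L y0 i2).
Proof.
move=> hL i12.
have [/forallP h1|] :=
    boolP [forall J : {set T}, #|J| <= slot_rank (drop_slot L y0 i1) J].
  by left=> J; apply: h1.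
have [/forallP h2 _|] :=
    boolP [forall J : {set T}, #|J| <= slot_rank (drop_slot L y0 i2) J].
  by right=> J; apply: h2.
move=> /forallPn[J2]; rewrite -ltnNge => l2 /forallPn[J1]; rewrite -ltnNge => l1.
have y1 : y0 \in J1.
  by apply: contraLR l1 => /slot_rank_drop_notin ->; rewrite -leqNgt.
have y2 : y0 \in J2.
  by apply: contraLR l2 => /slot_rank_drop_notin ->; rewrite -leqNgt.
have := leq_add (hL (J1 :|: J2)) (hL ((J1 :&: J2) :\ y0)).
move=> /leq_trans/(_ (slot_rank_drop_submod _ i12 y1 y2)).
have := cardsUI J1 J2; rewrite (cardsD1 y0 (J1 :&: J2)) inE y1 y2 /=.
by move: l1 l2; lia.
Qed.

Lemma hall_slot L y : hall L -> exists i, i \in L y.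
Proof.
move=> hL; apply/set0Pn; apply/eqP => L0; have := hL [set y].
rewrite cards1 /slot_rank big1 // => i _.
rewrite (_ : [set _ in _ | _] = set0) ?rho0 //.
by apply/setP => z; rewrite !inE; case: eqP => //= ->; rewrite L0 inE.
Qed.

(** Slots are deleted as long as some [y] has two of them; when each [y] is left
    with one slot, Hall's condition on a set of elements sharing slot [i]
    only involves [rho i]. *)
Lemma hall_choice L : hall L -> exists c : T -> I,
  forall i (J : {set T}), (forall y, y \in J -> c y = i) -> #|J| <= rho i J.
Proof.
have [k] := ubnP (\sum_y #|L y|); elim: k L => // k IHk L ltk hL.
have [/forallP L1|] := boolP [forall y, #|L y| <= 1]; last first.
  case/forallPn => y; rewrite -ltnNge => /card_gt1P[i1 [i2 [yi1 yi2 i12]]].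
  have decr i : i \in L y -> \sum_z #|drop_slot L y i z| < k.
    move=> iL; rewrite -ltnS; apply: leq_trans ltk; rewrite ltnS.
    rewrite (bigD1 y) //= [leqRHS](bigD1 y) //=.
    rewrite ffunE eqxx [#|L y|](cardsD1 i) iL addSn ltnS leq_add2l.
    apply: eq_leq; apply: eq_bigr => z /negbTE zy.
    by rewrite ffunE zy.
  by case: (hall_drop y hL i12) => /IHk; apply; apply: decr.
have /fin_all_exists[c cP] : forall y, exists i, i \in L y.
  by move=> y; apply: hall_slot.
exists c => i J Ji; apply: leq_trans (hL J) _.
rewrite /slot_rank (bigD1 i) //= big1 ?addn0 => [|j ji].
  by apply: rho_mono; apply/subsetP => y; rewrite inE => /andP[].
rewrite (_ : [set _ in _ | _] = set0) ?rho0 //.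
apply/setP => y; rewrite !inE; apply/negP => /andP[/Ji yi jL].
by rewrite -yi (card_le1_eqP (L1 y) _ _ jL (cP y)) eqxx in ji.
Qed.

(** The nontrivial direction of the matroid union theorem, with the rank
    functions of the matroids given abstractly. *)
Lemma rank_union :
  (forall J : {set T}, #|J| <= \sum_i rho i J) ->
  exists c : T -> I,
  forall i (J : {set T}), (forall y, y \in J -> c y = i) -> #|J| <= rho i J.
Proof.
move=> h; apply: (@hall_choice [ffun=> setT]) => J.
apply: leq_trans (h J) _; apply: leq_sum => i _; apply: rho_mono.
by apply/subsetP => y yJ; rewrite inE yJ ffunE inE.
Qed.
End RankUnion.

(** * Hilbert functions of finite sets in the plane *)

Section Hilbert.
Local Open Scope ring_scope.
Variable F : fieldType.
Notation bpoly := {mpoly F[2]}.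
Notation point := 'rV[F]_2.
Implicit Types (q : bpoly) (A B : point) (s t : seq point).

(** The dimension of the space of polynomials of degree at most [d]. *)
Definition nmon d := #|{: 'X_{1..2 < d.+1}}|.

Definition mon d (j : 'I_(nmon d)) : 'X_{1..2} := enum_val j.

Definition evrow d A : 'rV[F]_(nmon d) := \row_j ('X_[F, mon j]).@[A 0].
Definition coefrow d q : 'rV[F]_(nmon d) := \row_j q@_(mon j).
Definition rowpoly d (u : 'rV[F]_(nmon d)) : bpoly := \sum_j u 0 j *: 'X_[mon j].

Lemma mdeg_mon d (j : 'I_(nmon d)) : (mdeg (mon j) < d.+1)%N.
Proof. exact: bmdeg. Qed.

Lemma rowpolyK d : cancel (@rowpoly d) (coefrow d).
Proof.
move=> u; apply/rowP => j; rewrite mxE /rowpoly raddf_sum (bigD1 j) //=.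
rewrite mcoeffZ mcoeffX eqxx mulr1 big1 ?addr0 // => i ij.
rewrite mcoeffZ mcoeffX; case: eqP => [e|_]; last by rewrite mulr0.
by case/eqP: ij; apply: enum_val_inj; apply/val_inj.
Qed.

Lemma msize_rowpoly d (u : 'rV[F]_(nmon d)) : (msize (rowpoly u) <= d.+1)%N.
Proof.
rewrite /rowpoly; apply: leq_trans (msize_sum _ _ _) _.
apply/bigmax_leqP => j _; apply: leq_trans (msizeZ_le _ _) _.
by rewrite msizeX mdeg_mon.
Qed.

Lemma coefrowK d q : (msize q <= d.+1)%N -> rowpoly (coefrow d q) = q.
Proof.
move=> dq; rewrite [RHS](mpolywE dq) /rowpoly.
rewrite [RHS](reindex_onto (@enum_val _ _) enum_rank) /=.
  apply: eq_big => [j|j _]; first by rewrite enum_valK eqxx.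
  by rewrite mxE.
by move=> i _; rewrite enum_rankK.
Qed.

(** A row [u] is both the coefficient vector of a polynomial and a functional on
    evaluation rows; its value at the row of [A] is the value of the polynomial
    at [A]. *)
Lemma evrow_mulE d A (u : 'rV[F]_(nmon d)) :
  (evrow d A *m u^T) 0 0 = (rowpoly u).@[A 0].
Proof.
rewrite mxE /rowpoly raddf_sum /=; apply: eq_bigr => j _.
by rewrite !mxE mevalZ mulrC.
Qed.

Lemma evrow_ker d A (u : 'rV[F]_(nmon d)) :
  (evrow d A <= kermx u^T)%MS = ((rowpoly u).@[A 0] == 0).
Proof.
rewrite sub_kermx -evrow_mulE; apply/eqP/eqP => [->|e]; first by rewrite mxE.
by apply/matrixP => i j; rewrite !ord1 e mxE.
Qed.

Lemma meval_rowpoly_col d m A (M : 'M_(nmon d, m)) j :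
  (rowpoly (col j M)^T).@[A 0] = (evrow d A *m M) 0 j.
Proof. by rewrite -evrow_mulE trmxK colE mulmxA -colE mxE. Qed.

Lemma evrow_neq0 d A : evrow d A != 0.
Proof.
apply/eqP => e0; have := evrow_mulE A (coefrow d 1).
rewrite e0 mul0mx mxE coefrowK ?msize1 // meval1 => /esym/eqP.
by rewrite oner_eq0.
Qed.

(** The span of the evaluation functionals at the points of [s]; its rank is the
    Hilbert function of [s] in degree [d].  Points are listed in sequences, of
    which only the underlying set matters ([eq_hilb]). *)
Definition evspan d s := (\sum_(A <- s) <<evrow d A>>)%MS.
Definition hilb d s := \rank (evspan d s).

Lemma evspan_subP d s m (M : 'M_(m, nmon d)) :
  reflect (forall A, A \in s -> (evrow d A <= M)%MS) (evspan d s <= M)%MS.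
Proof.
rewrite /evspan; elim: s => [|A s IHs].
  by rewrite big_nil sub0mx; apply: ReflectT.
rewrite big_cons addsmx_sub genmxE; apply: (iffP andP) => [[AM /IHs sM] B|h].
  by rewrite inE => /orP[/eqP->|/sM].
split; first by apply: h; rewrite mem_head.
by apply/IHs => B Bs; apply: h; rewrite inE Bs orbT.
Qed.

Lemma evrow_span d s A : A \in s -> (evrow d A <= evspan d s)%MS.
Proof. by move: A; apply/evspan_subP. Qed.

Lemma evspanS d s t : {subset s <= t} -> (evspan d s <= evspan d t)%MS.
Proof. by move=> st; apply/evspan_subP => A /st; apply: evrow_span. Qed.

Lemma leq_hilb d s t : {subset s <= t} -> (hilb d s <= hilb d t)%N.
Proof. by move=> st; apply: mxrankS; apply: evspanS. Qed.

Lemma eq_hilb d s t : s =i t -> hilb d s = hilb d t.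
Proof.
by move=> st; apply/eqP; rewrite eqn_leq !leq_hilb // => A; rewrite st.
Qed.

(** Stated with inclusions, so that [u] and [v] may be any lists of the points of
    the union and of the intersection. *)
Lemma hilb_submod d (s t u v : seq point) :
  {subset u <= s ++ t} -> {subset v <= s} -> {subset v <= t} ->
  (hilb d u + hilb d v <= hilb d s + hilb d t)%N.
Proof.
move=> ust vs vt; rewrite /hilb -[leqRHS]mxrank_sum_cap leq_add // mxrankS //.
  apply: submx_trans (evspanS d ust) _.
  by rewrite /evspan big_cat.
by rewrite sub_capmx !evspanS.
Qed.

Lemma hilb_cons d A s :
  hilb d (A :: s) = (~~ (evrow d A <= evspan d s)%MS + hilb d s)%N.
Proof.
rewrite /hilb /evspan big_cons -/(evspan d s).
have [As|nAs] := boolP (evrow d A <= evspan d s)%MS.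
  by have /addsmx_idPr[-> _] : (<<evrow d A>> <= evspan d s)%MS by rewrite genmxE.
have := mxrank_sum_cap <<evrow d A>>%MS (evspan d s).
have -> : \rank <<evrow d A>>%MS = 1%N by rewrite genmxE rank_rV evrow_neq0.
suff -> : \rank (<<evrow d A>> :&: evspan d s)%MS = 0%N by rewrite addn0.
apply/eqP; rewrite -leqn0 -ltnS; apply: contraR nAs; rewrite -leqNgt => h.
have le1 : (\rank <<evrow d A>>%MS <= \rank (<<evrow d A>> :&: evspan d s)%MS)%N.
  by rewrite genmxE rank_rV evrow_neq0.
have := mxrank_leqif_sup (capmxSl <<evrow d A>>%MS (evspan d s)).
move=> [_]; rewrite eqn_leq le1 mxrankS ?capmxSl // => /esym.
by rewrite sub_capmx submx_refl genmxE.
Qed.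

Lemma hilb_size d s : (hilb d s <= size s)%N.
Proof.
elim: s => [|A s IHs]; first by rewrite /hilb /evspan big_nil mxrank0.
by rewrite hilb_cons /=; case: (_ <= _)%MS; rewrite ?add0n ?add1n // ltnW.
Qed.

Lemma hilb1 d A : hilb d [:: A] = 1%N.
Proof.
rewrite hilb_cons /hilb /evspan big_nil mxrank0 submx0.
by rewrite evrow_neq0.
Qed.

(** Duality: the columns of the cokernel of the span are the polynomials that
    vanish on [s]. *)
Lemma notin_evspanP d s A :
  reflect (exists q, [/\ (msize q <= d.+1)%N, q.@[A 0] != 0 &
                         forall B, B \in s -> q.@[B 0] = 0])
          (~~ (evrow d A <= evspan d s)%MS).
Proof.
apply: (iffP idP) => [|[q [dq qA qs]]]; last first.
  apply: contra qA => As; rewrite -(coefrowK dq) -evrow_ker.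
  apply: submx_trans As _; apply/evspan_subP => B Bs.
  by rewrite evrow_ker coefrowK // qs.
rewrite submxE => /rV0Pn[j]; set C := cokermx _ => AC.
exists (rowpoly (col j C)^T); split; first exact: msize_rowpoly.
  by rewrite meval_rowpoly_col.
move=> B Bs; rewrite meval_rowpoly_col; have := evrow_span d Bs.
by rewrite submxE -/C => /eqP->; rewrite mxE.
Qed.

Lemma hilb_ltP d s : (hilb d s < nmon d)%N -> exists q,
  [/\ (msize q <= d.+1)%N, q != 0 & forall B, B \in s -> q.@[B 0] = 0].
Proof.
move=> lt; have : \rank (cokermx (evspan d s)) != 0%N.
  by rewrite mxrank_coker -lt0n subn_gt0.
rewrite mxrank_eq0; set C := cokermx _ => /matrix0Pn[i [j Cij]].
exists (rowpoly (col j C)^T); split; first exact: msize_rowpoly.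
  apply: contra Cij => /eqP/(congr1 (coefrow d)); rewrite rowpolyK => /rowP/(_ i).
  by rewrite !mxE mcoeff0 => ->.
move=> B Bs; rewrite meval_rowpoly_col.
by have := evrow_span d Bs; rewrite submxE -/C => /eqP->; rewrite mxE.
Qed.

(** The matrix of multiplication by [q] on coefficient rows.  Products of degree
    greater than [n] are truncated, hence the degree conditions below. *)
Definition mulmat k n q : 'M[F]_(nmon k, nmon n) :=
  \matrix_(j, l) (q * 'X_[mon j])@_(mon l).

Lemma mulmatE k n q (u : 'rV[F]_(nmon k)) :
  u *m mulmat k n q = coefrow n (q * rowpoly u).
Proof.
apply/rowP => l; rewrite !mxE /rowpoly mulr_sumr raddf_sum /=.
by apply: eq_bigr => j _; rewrite !mxE -scalerAr mcoeffZ.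
Qed.

Lemma msize_mul_le d e q p : (msize q <= d.+1)%N -> (msize p <= e.+1)%N ->
  (msize (q * p) <= (d + e).+1)%N.
Proof.
have [->|q0] := eqVneq q 0; first by rewrite mul0r mmeasure0.
have [->|p0] := eqVneq p 0; first by rewrite mulr0 mmeasure0.
move=> hq hp; rewrite msizeM //; move: hq hp; move: (msize q) (msize p) => x y.
lia.
Qed.

Lemma mxrank_mulmat d k n q : (d + k <= n)%N -> (msize q <= d.+1)%N -> q != 0 ->
  \rank (mulmat k n q) = nmon k.
Proof.
move=> dk dq q0; apply/eqP; apply: inj_row_free => u.
rewrite mulmatE => /(congr1 (@rowpoly n)); rewrite coefrowK; last first.
  by apply: leq_trans (msize_mul_le dq (msize_rowpoly _)) _.
have -> : rowpoly (0 : 'rV[F]_(nmon n)) = 0.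
  by rewrite /rowpoly big1 // => j _; rewrite mxE scale0r.
move/eqP; rewrite mulf_eq0 (negbTE q0) /= => /eqP/(congr1 (coefrow k)).
rewrite rowpolyK => ->; apply/rowP => j; rewrite !mxE mcoeff0 //.
Qed.

(** Evaluating [q * p] at [A] is evaluating [p] at [A] and scaling: the transpose
    of multiplication by [q] acts diagonally on evaluation rows. *)
Lemma evrow_mulmat d k n q A : (d + k <= n)%N -> (msize q <= d.+1)%N ->
  evrow n A *m (mulmat k n q)^T = q.@[A 0] *: evrow k A.
Proof.
move=> dk dq; apply/rowP => j.
have -> : (evrow n A *m (mulmat k n q)^T) 0 j
    = (evrow n A *m ((delta_mx 0 j : 'rV_(nmon k)) *m mulmat k n q)^T) 0 0.
  by rewrite -rowE !mxE; apply: eq_bigr => l _; rewrite !mxE.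
rewrite mulmatE evrow_mulE coefrowK.
  rewrite mevalM mxE; congr (_ * _).
  by rewrite -evrow_mulE trmx_delta -colE mxE.
by apply: leq_trans (msize_mul_le dq (msize_rowpoly _)) _.
Qed.

(** All multiples of [q] vanish on [s], and they form a space of dimension
    [nmon k]. *)
Lemma hilb_curve d k n q s : (d + k <= n)%N -> (msize q <= d.+1)%N -> q != 0 ->
  (forall A, A \in s -> q.@[A 0] = 0) -> (hilb n s + nmon k <= nmon n)%N.
Proof.
move=> dk dq q0 qs; rewrite -(mxrank_mulmat dk dq q0) -[\rank (mulmat _ _ _)]mxrank_tr.
apply: mulmx0_rank_max; apply/eqP; rewrite -sub_kermx; apply/evspan_subP => A As.
by rewrite sub_kermx (evrow_mulmat _ dk dq) qs ?scale0r.
Qed.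

(** Multiples of [q] do not see [t], and on [u] they restrict as freely as their
    cofactors of degree [k] do.  In matrix terms, the transpose of multiplication
    by [q] kills the span of [t] and maps that of [s] onto a space containing
    the span of [u]. *)
Lemma hilb_residual d k n q s t u : (d + k <= n)%N -> (msize q <= d.+1)%N ->
  {subset t <= s} -> {subset u <= s} ->
  (forall A, A \in t -> q.@[A 0] = 0) -> (forall A, A \in u -> q.@[A 0] != 0) ->
  (hilb n t + hilb k u <= hilb n s)%N.
Proof.
move=> dk dq ts us qt qu; rewrite addnC /hilb.
rewrite -(mxrank_mul_ker (evspan n s) (mulmat k n q)^T).
apply: leq_add; apply: mxrankS.
  apply/evspan_subP => A Au; have -> : evrow k A = (q.@[A 0])^-1 *:
      (evrow n A *m (mulmat k n q)^T).
    by rewrite (evrow_mulmat _ dk dq) scalerA mulVf ?scale1r ?qu.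
  by apply: scalemx_sub; apply: submxMr; apply: evrow_span; apply: us.
rewrite sub_capmx evspanS //; apply/evspan_subP => A At.
by rewrite sub_kermx (evrow_mulmat _ dk dq) qt ?scale0r.
Qed.

Lemma nmonE d : nmon d = (\sum_(k < d.+1) k.+1)%N.
Proof.
(* Count by exact degree. *)
rewrite /nmon -sum1_card.
rewrite (partition_big (fun m : 'X_{1..2 < d.+1} => Ordinal (bmdeg m)) predT) //=.
apply: eq_bigr => k _; rewrite sum1dep_card.
have := size_basis 1 k; rewrite addn1 binSn => <-.
rewrite cardE -(size_map (@bmnm _ _)); apply/perm_size/uniq_perm.
- by rewrite map_inj_uniq ?enum_uniq //; apply: val_inj.
- exact: uniq_basis.
move=> m; rewrite -basis_cover; apply/mapP/eqP => [[b]|mk].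
  by rewrite mem_enum inE => /eqP/(congr1 val)/= <- ->.
have lt : (mdeg m < d.+1)%N by rewrite mk ltn_ord.
by exists (BMultinom lt) => //; rewrite mem_enum inE; apply/eqP/val_inj.
Qed.

Lemma nmon0 : nmon 0 = 1%N. Proof. by rewrite nmonE big_ord1. Qed.

Lemma nmonS d : nmon d.+1 = (nmon d + d.+2)%N.
Proof. by rewrite !nmonE [LHS]big_ord_recr. Qed.

Lemma nmon_bin d : nmon d = 'C(d + 2, 2).
Proof.
elim: d => [|d IHd]; first by rewrite nmon0.
by rewrite nmonS IHd !addn2 [in RHS]binS bin1.
Qed.

(** [n]-independence of a list of points, up to scaling the fundamental
    polynomials. *)
Definition separable n s := forall A, A \in s -> exists q,
  [/\ (msize q <= n.+1)%N, q.@[A 0] != 0 &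
      forall B, B \in s -> B != A -> q.@[B 0] = 0].

Lemma separableS n s t : {subset t <= s} -> separable n s -> separable n t.
Proof.
move=> ts sep A /ts/sep[q [nq qA qs]]; exists q; split=> // B /ts; exact: qs.
Qed.

Lemma hilb_separable n s : uniq s -> separable n s -> hilb n s = size s.
Proof.
elim: s => [|A s IHs] /=.
  by move=> _ _; apply/eqP; rewrite -leqn0 (hilb_size n [::]).
move=> /andP[As us] sep; rewrite hilb_cons IHs //; last first.
  by apply: separableS sep => B Bs; rewrite inE Bs orbT.
have [|q [nq qA qs]] := sep A; first exact: mem_head.
suff -> : ~~ (evrow n A <= evspan n s)%MS by [].
apply/notin_evspanP; exists q; split=> // B Bs.
by apply: qs; [rewrite inE Bs orbT | apply: contraNneq As => <-].
Qed.

Lemma separable_hilb n s : uniq s -> (size s <= hilb n s)%N -> separable n s.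
Proof.
move=> us hs A As; have /eq_hilb sE := perm_mem (perm_to_rem As).
have : ~~ (evrow n A <= evspan n (rem A s))%MS.
  have := hilb_size n (rem A s); rewrite size_rem // -ltnS.
  rewrite prednK => [|]; last by case: (s) As.
  by apply: contraTN => h; rewrite -leqNgt; move: hs; rewrite (sE n) hilb_cons h.
case/notin_evspanP => q [nq qA qs]; exists q; split=> // B Bs BA.
by apply: qs; rewrite mem_rem_uniq // inE BA.
Qed.

Definition coord_line (i : 'I_2) c : bpoly := 'X_i - c%:MP.

Lemma msize_coord_line i c : msize (coord_line i c) = 2%N.
Proof.
apply/eqP; rewrite eqn_leq; apply/andP; split.
  apply: leq_trans (msizeD_le _ _) _; rewrite msizeN msizeX mdeg1 msizeC geq_max /=.
  by case: (c != 0).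
have : U_(i)%MM \in msupp (coord_line i c).
  rewrite mcoeff_msupp mcoeffB mcoeffXU mcoeffC eqxx.
  by rewrite mnm1_eq0 mulr0 subr0 oner_eq0.
by move=> /msize_mdeg_lt; rewrite mdeg1.
Qed.

Lemma meval_coord_line i c A : (coord_line i c).@[A 0] = A 0 i - c.
Proof. by rewrite mevalB mevalXU mevalC. Qed.

Lemma line_separating A B : A != B -> exists q,
  [/\ msize q = 2%N, q.@[B 0] = 0 & q.@[A 0] != 0].
Proof.
move=> /eqP AB; have [i ABi] : exists i, A 0 i != B 0 i.
  apply/existsP; apply: contra_notT AB => /existsPn h; apply/rowP => i.
  by apply/eqP; have := h i; rewrite negbK.
exists (coord_line i (B 0 i)); split; first exact: msize_coord_line.
  by rewrite meval_coord_line subrr.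
by rewrite meval_coord_line subr_eq0.
Qed.

(** The fundamental polynomial of [A] is a product of lines, one through each
    other point and missing [A]. *)
Lemma hilb_small n s : uniq s -> (size s <= n.+1)%N -> hilb n s = size s.
Proof.
move=> us hs; apply: hilb_separable => // A As.
suff [q [nq qA qs]] : exists q, [/\ (msize q <= (size (rem A s)).+1)%N, q.@[A 0] != 0 &
    forall B, B \in rem A s -> q.@[B 0] = 0].
  exists q; split=> //; last by move=> B Bs BA; apply: qs; rewrite mem_rem_uniq // inE BA.
  by apply: leq_trans nq _; rewrite size_rem //; case: (size s) hs.
have : A \notin rem A s by rewrite mem_rem_uniqF.
elim: (rem A s) => [_|B t IHt].
  by exists 1; rewrite msize1 meval1 oner_eq0; split.
rewrite inE negb_or => /andP[/line_separating[l [l2 lB lA]] /IHt[q [nq qA qt]]].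
exists (l * q); split.
- by apply: leq_trans (msize_mul_le (_ : (msize l <= 2)%N) nq) _; rewrite ?l2.
- by rewrite mevalM mulf_neq0.
by move=> C; rewrite inE mevalM => /orP[/eqP->|/qt->]; rewrite ?lB ?mul0r ?mulr0.
Qed.
End Hilbert.

(** * The rank inequality for an independent set *)

Section RankInequality.
Local Open Scope ring_scope.
Variable F : fieldType.
Notation bpoly := {mpoly F[2]}.
Notation point := 'rV[F]_2.
Implicit Types (q : bpoly) (A B : point) (s t : seq point).

Lemma minn_leq_hilb d s : uniq s -> (minn (size s) d.+1 <= hilb d s)%N.
Proof.
move=> us; have sub : {subset take d.+1 s <= s} by move=> A /mem_take.
apply: leq_trans (leq_hilb d sub).
by rewrite hilb_small ?take_uniq ?size_take_min ?geq_minl // minnC.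
Qed.

Lemma hilb_leq_nmon d s : (hilb d s <= nmon d)%N.
Proof. exact: rank_leq_col. Qed.

(** Residuate with respect to a line [q]: [hilb 2 s] is at least
    [hilb 2 (on q) + hilb 1 (off q)].  If some line has three points of [s], take
    it as [q]: the first term is at least 3, so only one point can be off [q].
    Otherwise take the line through two points of [s]: three points off it would
    not be collinear and would contribute 3 to the 2 of the line. *)
Lemma hilb2_le4 s : uniq s -> (3 <= hilb 1 s)%N -> (4 <= size s)%N ->
  (hilb 2 s <= 4)%N -> hilb 2 s = 4%N /\
  ((size s <= 4)%N \/ exists q t, [/\ (msize q <= 2)%N, q != 0,
     (forall A, A \in t -> q.@[A 0] = 0), uniq t &
     {subset t <= s} /\ (size s <= (size t).+1)%N]).
Proof.
move=> us h1 s4 h2.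
pose on q := [seq A : point <- s | q.@[A 0] == 0].
pose off q := [seq A : point <- s | q.@[A 0] != 0].
have on0 q A : A \in on q -> q.@[A 0] = 0 by rewrite mem_filter => /andP[/eqP].
have off0 q A : A \in off q -> q.@[A 0] != 0 by rewrite mem_filter => /andP[].
have ons q : {subset on q <= s} by move=> A; rewrite mem_filter => /andP[].
have offs q : {subset off q <= s} by move=> A; rewrite mem_filter => /andP[].
have onoff q : size s = (size (on q) + size (off q))%N.
  by rewrite !size_filter -(count_predC (fun A : point => q.@[A 0] == 0)).
have uon q : uniq (on q) by rewrite filter_uniq.
have uoff q : uniq (off q) by rewrite filter_uniq.
have res q : (msize q <= 2)%N -> (hilb 2 (on q) + hilb 1 (off q) <= hilb 2 s)%N.
  by move=> q2; apply: (@hilb_residual _ 1 1 2 q) => //; [exact: on0|exact: off0].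
have offn0 q : (msize q <= 2)%N -> q != 0 -> (0 < size (off q))%N.
  move=> q2 q0; rewrite lt0n; apply/negP => /eqP/size0nil e.
  have := @hilb_curve _ 1 0 1 q s isT q2 q0.
  rewrite nmonS nmon0 => h; suff /h : forall A, A \in s -> q.@[A 0] = 0 by lia.
  move=> A As; apply/eqP; apply: contraT => qA.
  have : A \in off q by rewrite mem_filter qA.
  by rewrite e.
have m2 := minn_leq_hilb 2 (uon _); have m1 := minn_leq_hilb 1 (uoff _).
have nm1 : nmon 1 = 3%N by rewrite nmonS nmon0.
have fewlines q t : (msize q <= 2)%N -> q != 0 -> (forall A, A \in t -> q.@[A 0] = 0) ->
    (hilb 1 t < 3)%N.
  by move=> q2 q0 qt; have := @hilb_curve _ 1 0 1 q t isT q2 q0 qt; rewrite nm1 nmon0 addn1.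
(* Lines with three points of [s] are sought through the finitely many sublists. *)
pose P (m : (size s).-tuple bool) := (2 < size (mask m s))%N && (hilb 1 (mask m s) < 3)%N.
have [/existsP[m /andP[m3 hm]]|/existsPn none] := boolP [exists m, P m].
  have [|q [q2 q0 qm]] := @hilb_ltP _ 1 (mask m s); first by rewrite nm1.
  have : (size (mask m s) <= size (on q))%N.
    apply: uniq_leq_size; first exact: mask_uniq.
    by move=> A Am; rewrite mem_filter qm // eqxx (mem_mask Am).
  have := res q q2; have := offn0 q q2 q0; have := m1 q; have := m2 q.
  move: (onoff q) => /= e1 e2 e3 e4 e5 e6; split; first by lia.
  right; exists q, (on q); split=> //; first exact: on0.
  by split; [exact: ons|lia].
have two q : (msize q <= 2)%N -> q != 0 -> (size (on q) <= 2)%N.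
  move=> q2 q0; have := none (map_tuple (fun A : point => q.@[A 0] == 0) (in_tuple s)).
  rewrite /P /= -filter_mask -/(on q) (fewlines q) ?andbT -?leqNgt //; exact: on0.
(* No line contains three points of [s]: use the line through two of them. *)
have [A [B [u es]]] : exists A B u, s = [:: A, B & u].
  by move: s4; case: (s) => [//|A [//|B u]] _; exists A, B, u.
have AB : uniq [:: A; B] by move: us; rewrite es /= !inE negb_or => /andP[/andP[-> _] _].
have [|q [q2 q0 qAB]] := @hilb_ltP _ 1 [:: A; B].
  by rewrite nm1 ltnS; apply: hilb_size.
have ABq : {subset [:: A; B] <= on q}.
  move=> C CAB; rewrite mem_filter qAB // eqxx es.
  by move: CAB; rewrite !inE => /orP[]->; rewrite ?orbT.
have two_on : size (on q) = 2%N.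
  by apply/eqP; rewrite eqn_leq two //=; apply: (uniq_leq_size AB ABq).
have := res q q2; have := m2 q; rewrite two_on => g2.
have := onoff q; rewrite two_on => gs.
have [off3|off2] := leqP 3 (size (off q)).
  suff : (2 < hilb 1 (off q))%N by lia.
  rewrite ltnNge; apply/negP => hoff.
  have [|q' [q'2 q'0 q'off]] := @hilb_ltP _ 1 (off q); first by rewrite nm1.
  have : (size (off q) <= size (on q'))%N.
    apply: uniq_leq_size => // C Coff; rewrite mem_filter q'off // eqxx; exact: offs Coff.
  by have := two q' q'2 q'0; lia.
by move: (m1 q) => g1 g3; split; [lia | left; lia].
Qed.

(** The value of [hilb 2 (A :: s)] decides which bound on [size s] is used: the
    global one for the value 6, that for nodes on a conic for 5, and that for
    nodes on a line below 5 or when all the nodes are collinear. *)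
Lemma matroid_rank_inequality n A s : (0 < n)%N -> uniq (A :: s) -> separable n (A :: s) ->
  (size s <= 2 * n + n./2)%N ->
  (size s <= n./2 * (hilb 2 (A :: s)).-1 + odd n * (hilb 1 (A :: s)).-1)%N.
Proof.
move=> n0 us sep hs; set S := A :: s in us sep *.
have sS : size S = (size s).+1 by [].
have nm1 : nmon 1 = 3%N by rewrite nmonS nmon0.
have nm2 : nmon 2 = 6%N by rewrite nmonS nm1.
have on_curve d k q t : (d + k = n)%N -> (msize q <= d.+1)%N -> q != 0 ->
    (forall B, B \in t -> q.@[B 0] = 0) -> uniq t -> {subset t <= S} ->
    (size t + nmon k <= nmon n)%N.
  move=> dk dq q0 qt ut tS; rewrite -(hilb_separable ut (separableS tS sep)).
  by apply: (hilb_curve _ dq q0 qt); rewrite dk.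
have on_line q t : (msize q <= 2)%N -> q != 0 ->
    (forall B, B \in t -> q.@[B 0] = 0) -> uniq t -> {subset t <= S} ->
    (size t <= n.+1)%N.
  move=> q2 q0 qt ut tS; have := on_curve 1%N n.-1 q t; rewrite add1n prednK // => /(_ erefl).
  move=> /(_ q2 q0 qt ut tS).
  by case: (n) n0 => // k _ /=; rewrite nmonS addnC leq_add2l.
have e2 := odd_double_half n; rewrite -mul2n in e2.
have b1 := hilb_leq_nmon 1 S.
have m2 := minn_leq_hilb 2 us; have m1 := minn_leq_hilb 1 us.
rewrite nm1 in b1; rewrite sS in m1 m2.
(* The two ranks only have to be bounded from below. *)
suff [a [b [ha hb hab]]] : exists a b, [/\ (a < hilb 2 S)%N, (b < hilb 1 S)%N
    & (size s <= n./2 * a + odd n * b)%N].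
  apply: leq_trans hab _; apply: leq_add; apply: leq_mul => //; lia.
have [h1|h1] := ltnP (hilb 1 S) 3.
  have [|q [q2 q0 qS]] := @hilb_ltP _ 1 S; first by rewrite nm1.
  have := on_line q S q2 q0 qS us (fun _ x => x); rewrite sS => szs.
  have [s1|s1] := leqP (size s) 1.
    by exists (size s), (size s); split; [lia|lia|nia].
  by exists 2%N, 1%N; split; lia.
have {}h1 : hilb 1 S = 3%N by apply/eqP; rewrite eqn_leq b1.
have [n1|n1] := leqP n 1.
  have -> : n = 1%N by lia.
  by exists 0%N, 2%N; rewrite h1; split=> //; lia.
have [h2|h2] := ltnP 5 (hilb 2 S).
  by exists 5%N, 2%N; rewrite h1; split=> //; lia.
have szs : (size s <= 2 * n)%N.
  have [|q [q3 q0 qS]] := @hilb_ltP _ 2 S; first by rewrite nm2.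
  have := on_curve 2%N n.-2 q S; rewrite sS.
  have -> : (2 + n.-2 = n)%N by lia.
  move=> /(_ erefl q3 q0 qS us (fun _ x => x)).
  have -> : nmon n = nmon n.-2.+2 by congr nmon; lia.
  by rewrite !nmonS; lia.
have [h4|h4] := ltnP 4 (hilb 2 S).
  by exists 4%N, 2%N; rewrite h1; split=> //; lia.
have [s3|s3] := leqP (size s) 2.
  by have := hilb_size 1 S; exists 2%N, 2%N; rewrite h1; split=> //; lia.
have h1' : (2 < hilb 1 S)%N by rewrite h1.
have [] := hilb2_le4 us h1' _ h4; rewrite ?sS // => h2e [s4|[q [t [q2 q0 qt ut [tS st]]]]].
  by exists 3%N, 2%N; rewrite h1 h2e; split=> //; lia.
have := on_line q t q2 q0 qt ut tS.
by exists 3%N, 2%N; rewrite h1 h2e; split=> //; lia.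
Qed.
End RankInequality.

(** * Products of lines and conics through few nodes *)

Section Cover.
Local Open Scope ring_scope.
Variable F : fieldType.
Notation bpoly := {mpoly F[2]}.
Notation point := 'rV[F]_2.

(** The matroid of slot [i] lives on [s] and has rank [(hilb (d i) (A :: J)).-1].
    In an independent class the evaluation at [A] is not in the span of the
    evaluations at the class, so some curve of degree [d i] contains the class
    and misses [A]. *)
Lemma curve_cover (I : finType) (d : I -> nat) (A : point) (s : seq point) :
  (forall t, uniq t -> {subset t <= s} ->
     (size t <= \sum_i (hilb (d i) (A :: t)).-1)%N) ->
  exists f : I -> bpoly,
    (forall i, (msize (f i) <= (d i).+1)%N /\ (f i).@[A 0] != 0) /\
    (forall B, B \in s -> exists i, (f i).@[B 0] = 0).
Proof.
move=> h; pose pts (J : {set seq_sub s}) : seq point := [seq val y | y <- enum J].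
have ptsP J y : (val y \in pts J) = (y \in J).
  by rewrite mem_map ?mem_enum //; apply: val_inj.
have ptsE J B : B \in pts J -> exists2 y, y \in J & B = val y.
  by case/mapP => y; rewrite mem_enum; exists y.
have upts J : uniq (pts J) by rewrite map_inj_uniq ?enum_uniq //; apply: val_inj.
have szpts J : size (pts J) = #|J| by rewrite size_map cardE.
have ptsS J : {subset pts J <= s} by move=> B /ptsE[y _ ->]; apply: valP.
pose rho i J := (hilb (d i) (A :: pts J)).-1.
have rhoS i J : (rho i J).+1 = hilb (d i) (A :: pts J).
  rewrite prednK //; have : (hilb (d i) [:: A] <= hilb (d i) (A :: pts J))%N.
    by apply: leq_hilb => B; rewrite !inE => /eqP->; rewrite eqxx.
  by rewrite hilb1.
have [||i J K|J|c cP] := @rank_union _ _ rho.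
- move=> i; rewrite /rho (_ : pts set0 = [::]) ?hilb1 //.
  by apply: size0nil; rewrite szpts cards0.
- move=> i J K /subsetP JK; rewrite -ltnS !rhoS; apply: leq_hilb => B.
  rewrite !inE => /orP[->//|/ptsE[y /JK yK ->]].
  by rewrite ptsP yK orbT.
- suff : ((rho i (J :|: K)).+1 + (rho i (J :&: K)).+1 <=
          (rho i J).+1 + (rho i K).+1)%N by rewrite !addSn !addnS !ltnS.
  rewrite !rhoS.
  apply: hilb_submod => B; rewrite ?mem_cat !inE => /orP[->//|/ptsE[y yJK ->]].
  + by move: yJK; rewrite !ptsP inE => /orP[]->; rewrite !orbT.
  + by move: yJK; rewrite !ptsP inE => /andP[-> _]; rewrite orbT.
  + by move: yJK; rewrite !ptsP inE => /andP[_ ->]; rewrite orbT.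
- by rewrite -szpts; apply: h.
pose C i := [set y | c y == i].
have sepC i : ~~ (evrow (d i) A <= evspan (d i) (pts (C i)))%MS.
  have : (#|C i| <= rho i (C i))%N by apply: cP => y; rewrite inE => /eqP.
  rewrite -ltnS rhoS hilb_cons; case: (_ <= _)%MS => //=.
  by rewrite ltnNge -szpts hilb_size.
have /fin_all_exists[f fP] i := notin_evspanP _ _ _ (sepC i).
exists f; split=> [i|B Bs]; first by have [] := fP i.
exists (c (SeqSub Bs)); have [_ _] := fP (c (SeqSub Bs)); apply.
by rewrite (ptsP _ (SeqSub Bs)) inE.
Qed.
End Cover.

Section Products.
Local Open Scope ring_scope.
Variable R : realType.
Notation bpoly := {mpoly R[2]}.
Notation point := 'rV[R]_2.

Lemma msize_prod_le (s : seq bpoly) :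
  (msize (\prod_(f <- s) f)%R <= (\sum_(f <- s) (msize f).-1).+1)%N.
Proof.
elim: s => [|f s IHs]; first by rewrite !big_nil msize1.
rewrite !big_cons; apply: msize_mul_le IHs; exact: leqSpred.
Qed.

(** A curve found for a slot may have smaller degree than the slot allows.
    Constant factors are dropped: being nonzero at [A], they contain no node.
    If nothing remains, any line missing [A] serves as the product. *)
Lemma product_cover (I : finType) (d : I -> nat) (n : nat) (A : point)
    (f : I -> bpoly) :
  (0 < n)%N -> (forall i, (d i <= 2)%N) -> (\sum_i d i <= n)%N ->
  (forall i, (msize (f i) <= (d i).+1)%N /\ (f i).@[A 0] != 0) ->
  exists p, [/\ in_Pi n p, p.@[A 0] = 1, product_of_lines_and_conics p &
    forall B : point, (exists i, (f i).@[B 0] = 0) -> p.@[B 0] = 0].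
Proof.
move=> n0 d2 dn fP.
have ok (s : seq bpoly) : s != [::] ->
    (forall g, g \in s -> [/\ (1 < msize g)%N, (msize g <= 3)%N & g.@[A 0] != 0]) ->
    (\sum_(g <- s) (msize g).-1 <= n)%N ->
    exists p, [/\ in_Pi n p, p.@[A 0] = 1, product_of_lines_and_conics p &
    forall B : point, (exists2 g, g \in s & g.@[B 0] = 0) -> p.@[B 0] = 0].
  move=> s0 sP sn; pose P := \prod_(g <- s) g.
  have evP (B : point) : P.@[B 0] = \prod_(g <- s) g.@[B 0].
    by rewrite /P rmorph_prod.
  have PA : P.@[A 0] != 0.
    by rewrite evP prodf_seq_neq0; apply/allP => g /sP[].
  exists (P.@[A 0]^-1 *: P); split.
  - by apply: leq_trans (msizeZ_le _ _) _; apply: leq_trans (msize_prod_le s) _.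
  - by rewrite mevalZ mulVf.
  - exists (P.@[A 0]^-1), s; split=> //; first by rewrite invr_neq0.
    move=> g /sP[g1 g3 _]; rewrite /is_line /is_conic; move: g1 g3.
    by case: (msize g) => [|[|[|[|k]]]] // _ _; [left|right].
  by move=> B [g gs gB]; rewrite mevalZ (evP B) (big_rem _ gs) /= gB mul0r mulr0.
pose s := [seq f i | i <- enum I & (1 < msize (f i))%N].
have sP g : g \in s -> [/\ (1 < msize g)%N, (msize g <= 3)%N & g.@[A 0] != 0].
  case/mapP => i; rewrite mem_filter => /andP[f1 _] ->; split=> //.
    by have [h _] := fP i; apply: leq_trans h _; rewrite ltnS.
  by have [] := fP i.
have fs (B : point) i : (f i).@[B 0] = 0 -> f i \in s.
  move=> fB; apply: map_f; rewrite mem_filter mem_enum andbT ltnNge.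
  apply/negP => /msize1_polyC fC; have [_] := fP i.
  by move: fB; rewrite fC !mevalC => ->; rewrite eqxx.
have [s0|s0] := eqVneq s [::].
  pose l : bpoly := coord_line 0 (A 0 0 - 1).
  have [|g||p [pn pA pl _]] := ok [:: l] => //.
  - rewrite inE => /eqP->; rewrite msize_coord_line; split=> //.
    by rewrite meval_coord_line opprB addrC subrK oner_eq0.
  - by rewrite big_seq1 msize_coord_line.
  exists p; split=> // B [i /fs]; by rewrite s0.
have [|p [pn pA pl pB]] := ok s s0 sP.
  apply: leq_trans dn; rewrite /s big_map big_filter big_enum_cond /=.
  rewrite big_mkcond /=; apply: leq_sum => i _; case: ifP => // _.
  by have [] := fP i; case: (msize (f i)).
by exists p; split=> // B [i fB]; apply: pB; exists (f i) => //; apply: fs fB.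
Qed.

Lemma fundamental_product_exists n (X : {fset point}) : (1 <= n)%N -> independent n X ->
  (#|` X| <= 2 * n + n./2 + 1)%N -> forall A, A \in X ->
  exists p, fundamental n X A p /\ product_of_lines_and_conics p.
Proof.
move=> n0 indX cX A AX.
have sepX : separable n X.
  move=> B /indX[q [nq qB qX]]; exists q; split=> //.
  by rewrite qB oner_eq0.
pose s : seq point := (X `\ A)%fset.
have ss : (size s <= 2 * n + n./2)%N.
  by move: cX; rewrite (cardfsD1 A) AX /= add1n addn1 ltnS.
have sX B : B \in s = (B != A) && (B \in X) by rewrite in_fsetD1.
pose d (i : 'I_(n./2) + 'I_(odd n)) := if i is inl _ then 2%N else 1%N.
have [t ut ts|f [fP fB]] := @curve_cover _ _ d A s.
  rewrite big_sumType /= !sum_nat_const !card_ord.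
  apply: matroid_rank_inequality => //.
  - by rewrite /= ut andbT; apply/negP => /ts; rewrite sX eqxx.
  - apply: separableS sepX => B; rewrite inE => /orP[/eqP->//|/ts].
    by rewrite sX => /andP[].
  by apply: leq_trans ss; apply: uniq_leq_size.
have [||//|p [pn pA pl pB]] := @product_cover _ d n A f n0.
- by case.
- rewrite big_sumType /= !sum_nat_const !card_ord muln1 muln2 addnC.
  by rewrite odd_double_half.
exists p; split=> //; split=> // B BX BA; apply: pB; apply: fB.
by rewrite sX BA.
Qed.
End Products.

(** * Nodes in general position *)

Section Generic.
Local Open Scope ring_scope.
Variable F : numFieldType.
Notation bpoly := {mpoly F[2]}.
Notation point := 'rV[F]_2.

Definition vanish (q : bpoly) : pred point := fun B => q.@[B 0] == 0.

Lemma poly_nonroot (P : {poly F}) : P != 0 -> exists x, P.[x] != 0.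
Proof.
move=> P0; pose rs : seq F := [seq i%:R | i <- iota 0 (size P)].
have [/allP rts|/allPn[x _ Px]] := boolP (all (root P) rs); last by exists x.
have urs : uniq rs.
  by rewrite map_inj_uniq ?iota_uniq // => i j /eqP; rewrite eqr_nat => /eqP.
have /(_ urs) := max_poly_roots P0 (introT allP rts).
by rewrite size_map size_iota ltnn.
Qed.

(** Kronecker substitution: putting [(x ^+ K, x)] for the two variables, with [K]
    above the degree, keeps distinct monomials distinct, so the polynomial in
    [x] is again nonzero. *)
Lemma bpoly_nonroot (q : bpoly) : q != 0 -> exists B : point, q.@[B 0] != 0.
Proof.
move=> q0; set K := msize q.
pose e (m : 'X_{1..2}) := (m 0%R * K + m 1%R)%N.
pose P : {poly F} := \sum_(m : 'X_{1..2 < K}) q@_m *: 'X^(e m).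
have degE (m : 'X_{1..2}) : mdeg m = (m 0%R + m 1%R)%N.
  by rewrite mdegE big_ord_recl big_ord1; congr (_ + m _)%N; apply: val_inj.
have e_inj (m m' : 'X_{1..2 < K}) : e m = e m' -> m = m'.
  move=> emm; apply/val_inj => /=.
  have l1 := bmdeg m; have l2 := bmdeg m'; rewrite !degE in l1 l2.
  have K0 : (0 < K)%N by lia.
  have l1' : (bmnm m 1%R < K)%N by lia.
  have l2' : (bmnm m' 1%R < K)%N by lia.
  have h1 : bmnm m 1%R = bmnm m' 1%R.
    by have := congr1 (modn^~ K) emm; rewrite /= !modnMDl !modn_small.
  have h0 : bmnm m 0%R = bmnm m' 0%R.
    by have := congr1 (divn^~ K) emm; rewrite /= !divnMDl // !divn_small // !addn0.
  apply/mnmP => -[[|[|//]] i].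
    by have -> : Ordinal i = 0 by apply: val_inj.
  by have -> : Ordinal i = 1 by apply: val_inj.
have P0 : P != 0.
  have [m mq] : exists m, m \in msupp q.
    move: q0; rewrite -msupp_eq0; case: (msupp q) => // m l _.
    by exists m; rewrite mem_head.
  have mK : (mdeg m < K)%N by apply: msize_mdeg_lt.
  apply: contraTneq mq => /(congr1 (fun p : {poly F} => p`_(e m))).
  rewrite coef0 /P coef_sum (bigD1 (BMultinom mK)) //= coefZ coefXn eqxx mulr1.
  rewrite big1 ?addr0 => [/eqP|m' mm']; first by rewrite mcoeff_eq0.
  rewrite coefZ coefXn; case: eqP => [e'|_]; last by rewrite mulr0.
  by rewrite (e_inj m' (BMultinom mK)) ?eqxx in mm'.
have [x Px] := poly_nonroot P0.
exists (\row_i (if i == 0 then x ^+ K else x)); apply: contra Px => /eqP qB.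
apply/eqP; rewrite -[RHS]qB {1}(mpolywE (leqnn K)) /P raddf_sum horner_sum /=.
apply: eq_bigr => m _; rewrite hornerZ hornerXn mevalZ mevalX; congr (_ * _).
rewrite big_ord_recl big_ord1 !mxE /= exprD -exprM mulnC; congr (_ * x ^+ m _).
exact: val_inj.
Qed.

(** For each pair [(d, t)] some nonzero polynomial of degree at most [d] vanishes
    on [t]; any point where the product of these polynomials is nonzero will
    do. *)
Lemma point_avoiding_spans (L : seq (nat * seq point)) :
  (forall x, x \in L -> (hilb x.1 x.2 < nmon x.1)%N) ->
  exists B : point, forall x, x \in L -> ~~ (evrow x.1 B <= evspan x.1 x.2)%MS.
Proof.
move=> hL; suff [Q Q0 QL] : exists2 Q : bpoly, Q != 0 & forall (B : point) x,
    Q.@[B 0] != 0 -> x \in L -> ~~ (evrow x.1 B <= evspan x.1 x.2)%MS.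
  by have [B QB] := bpoly_nonroot Q0; exists B => x; apply: QL.
elim: L hL => [|x L IHL] hL; first by exists 1; rewrite ?oner_neq0.
have [|Q Q0 QL] := IHL; first by move=> y yL; apply: hL; rewrite inE yL orbT.
have [q [dq q0 qx]] := hilb_ltP (hL x (mem_head _ _)).
exists (q * Q) => [|B y]; first by rewrite mulf_neq0.
rewrite mevalM mulf_eq0 negb_or inE => /andP[qB QB] /orP[/eqP->|]; last exact: QL.
by apply/notin_evspanP; exists q.
Qed.

(** General position with respect to curves of all degrees up to [n]. *)
Definition generic n (s : seq point) := forall d t, (d <= n)%N -> uniq t ->
  {subset t <= s} -> (size t <= nmon d)%N -> hilb d t = size t.

(** The new point is chosen outside the span of every subset that does not yet
    fill its degree.  Applied in degree [n] to [s] itself, this also makes it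
    a new point. *)
Lemma generic_cons n s : uniq s -> generic n s -> (size s < nmon n)%N ->
  exists B, uniq (B :: s) /\ generic n (B :: s).
Proof.
move=> us gs sn.
pose subs := [seq mask (m : (size s).-tuple bool) s | m : (size s).-tuple bool].
pose L := [seq x <- [seq (d, t) | d <- iota 0 n.+1, t <- subs] |
  (hilb x.1 x.2 < nmon x.1)%N].
have [x|B BL] := @point_avoiding_spans L; first by rewrite mem_filter => /andP[].
have out d t : (d <= n)%N -> uniq t -> {subset t <= s} -> (size t < nmon d)%N ->
    ~~ (evrow d B <= evspan d t)%MS.
  move=> dn ut ts td.
  (* the list among [subs] with the same points as [t] *)
  pose t' := [seq A <- s | A \in t].
  have tt' : t =i t' by move=> A; rewrite mem_filter andb_idr //; apply: ts.
  have /eqmxP eq_span : (evspan d t == evspan d t')%MS.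
    by rewrite !evspanS // => A; rewrite tt'.
  rewrite eq_span; apply: (BL (d, t')); rewrite mem_filter; apply/andP; split.
    by rewrite /= -(eq_hilb d tt'); apply: leq_ltn_trans td; apply: hilb_size.
  apply/allpairsPdep; exists d, t'; rewrite mem_iota /=; split=> //.
  apply/mapP; exists (map_tuple (mem t) (in_tuple s)); first by rewrite mem_enum.
  by rewrite /t' filter_mask.
have Bs : B \notin s.
  apply: contraL (out n s (leqnn n) us (fun _ x => x) sn) => Bs.
  by rewrite negbK evrow_span.
exists B; split=> [|d t dn ut tB td]; first by rewrite /= Bs.
have [Bt|Bt] := boolP (B \in t); last first.
  apply: gs => // A At; have := tB A At; rewrite inE => /orP[/eqP AB|//].
  by rewrite -AB At in Bt.
have us' : uniq (rem B t) by rewrite rem_uniq.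
have subs' : {subset rem B t <= s}.
  move=> A; rewrite mem_rem_uniq // inE => /andP[AB /tB].
  by rewrite inE (negbTE AB).
have szt : size t = (size (rem B t)).+1.
  by rewrite size_rem // prednK //; case: (t) Bt.
rewrite szt in td *; rewrite (eq_hilb d (perm_mem (perm_to_rem Bt))) hilb_cons.
by rewrite (out d) // (gs d) // ltnW.
Qed.

Lemma generic_exists n k : (k <= nmon n)%N ->
  exists s, [/\ uniq s, size s = k & generic n s].
Proof.
elim: k => [_|k IHk kn].
  exists [::]; split=> // d [|A t] _ _ sub _; last by have := sub A (mem_head _ _).
  by apply/eqP; rewrite -leqn0 (hilb_size d [::]).
have [s [us sk gs]] := IHk (ltnW kn).
have [|B [uB gB]] := generic_cons us gs; first by rewrite sk.
by exists (B :: s); rewrite /= sk.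
Qed.

(** [nmon d] points of [s] on the curve would impose independent conditions in
    degree [d], leaving only the zero polynomial. *)
Lemma generic_zeros n s d (q : bpoly) : uniq s -> generic n s -> (d <= n)%N ->
  (msize q <= d.+1)%N -> q != 0 -> (count (vanish q) s < nmon d)%N.
Proof.
move=> us gs dn dq q0; rewrite -size_filter ltnNge; apply/negP => h.
set z := filter _ s in h; pose t := take (nmon d) z.
have tz : {subset t <= z} by move=> B /mem_take.
have qt B : B \in t -> q.@[B 0] = 0 by move=> /tz; rewrite mem_filter => /andP[/eqP].
have := @hilb_curve _ d 0 d q t _ dq q0 qt; rewrite addn0 leqnn => /(_ isT).
have st : size t = nmon d by rewrite size_takel.
rewrite (gs d) ?st ?nmon0 ?addn1 ?ltnn //.
  by rewrite take_uniq // filter_uniq.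
by move=> B /tz; rewrite mem_filter => /andP[].
Qed.
End Generic.

Lemma count_has_le (T : Type) (I : Type) (Z : I -> pred T) (s : seq I) (u : seq T) :
  (count (fun B => has (Z^~ B) s) u <= \sum_(f <- s) count (Z f) u)%N.
Proof.
elim: s => [|f s IHs] /=; first by rewrite count_pred0.
rewrite big_cons; apply: leq_trans (leq_add (leqnn _) IHs).
by rewrite -count_predUI leq_addr.
Qed.

(** * Sharpness of the bound *)

Section Sharpness.
Local Open Scope ring_scope.
Variable R : realType.
Notation bpoly := {mpoly R[2]}.
Notation point := 'rV[R]_2.

Lemma msize_prod (s : seq bpoly) : (forall f, f \in s -> f != 0) ->
  msize (\prod_(f <- s) f)%R = (\sum_(f <- s) (msize f).-1).+1%N.
Proof.
elim: s => [|f s IHs] s0; first by rewrite !big_nil msize1.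
have f0 : f != 0 by apply: s0; rewrite mem_head.
have {}s0 g : g \in s -> g != 0 by move=> gs; apply: s0; rewrite inE gs orbT.
rewrite !big_cons msizeM ?IHs //.
  by move: f0; rewrite -msize_poly_eq0 addnS; case: (msize f).
by rewrite prodf_seq_neq0; apply/allP.
Qed.

(** With a line containing at most 2 nodes and a conic at most 5, a factor of
    degree [k] contains at most [5k/2] nodes. *)
Lemma fundamental_not_product n : (3 <= n)%N -> forall k : nat,
  (2 * n + n./2 + 2 <= k <= 'C(n + 2, 2))%N ->
  exists X : {fset point}, [/\ independent n X, #|` X| = k &
    exists2 A, A \in X & forall p, fundamental n X A p -> ~ product_of_lines_and_conics p].
Proof.
move=> n3 k /andP[lk ku]; rewrite -nmon_bin in ku.
have [s [us sk gs]] := @generic_exists R n k ku.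
pose X := [fset B in s]%fset.
have XE B : (B \in X) = (B \in s) by rewrite inE.
exists X; split.
- have sep : separable n s by apply: separable_hilb => //; rewrite (gs n) ?sk.
  move=> A; rewrite XE => /sep[q [nq qA qs]].
  exists (q.@[A 0]^-1 *: q); split.
  + by apply: leq_trans (msizeZ_le _ _) _.
  + by rewrite mevalZ mulVf.
  by move=> B; rewrite XE mevalZ => Bs BA; rewrite (qs B Bs BA) mulr0.
- by rewrite card_fseq undup_id.
case es : s => [|A s']; first by move: sk; rewrite es /=; lia.
exists A; first by rewrite XE es mem_head.
move=> p [np pA pX] [c [fs [c0 _ fsP pE]]].
have fs0 f : f \in fs -> f != 0.
  by move=> /fsP[]; rewrite -msize_poly_eq0 => ->.
have degs : (\sum_(f <- fs) (msize f).-1 <= n)%N.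
  by rewrite -ltnS -msize_prod // -(msizeZ _ c0) -pE.
have zeros f : f \in fs ->
    (2 * count (vanish f) s <= 5 * (msize f).-1)%N.
  move=> ffs; have f0 := fs0 f ffs.
  case: (fsP f ffs) => e; rewrite e.
    have := @generic_zeros _ n s 1 f us gs _ _ f0.
    by rewrite e nmonS nmon0 => /(_ _ isT); lia.
  have := @generic_zeros _ n s 2 f us gs _ _ f0.
  by rewrite e !nmonS nmon0 => /(_ _ isT); lia.
have : (size s' <= \sum_(f <- fs) count (vanish f) s)%N.
  apply: leq_trans (count_has_le _ _ _).
  have : all (fun B => has (fun f => vanish f B) fs) s'.
    apply/allP => B Bs; have BA : B != A.
      by apply: contraTneq Bs => ->; move: us; rewrite es => /andP[].
    have := pX B; rewrite XE es inE Bs orbT => /(_ isT BA)/eqP.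
    rewrite pE mevalZ mulf_eq0 (negbTE c0) /= rmorph_prod /=.
    by rewrite prodf_seq_eq0; apply: sub_has.
  by rewrite all_count es /= => /eqP ->; rewrite leq_addl.
have : (2 * \sum_(f <- fs) count (vanish f) s <= 5 * n)%N.
  apply: leq_trans (leq_mul (leqnn 5) degs); rewrite !big_distrr /=.
  by rewrite !big_seq; apply: leq_sum.
have := odd_double_half n; move: sk; rewrite es /=.
by case: (odd n); lia.
Qed.
End Sharpness.

Theorem theorem3p1 (R : realType) :
  (forall n : nat, (1 <= n)%N ->
   forall X : {fset 'rV[R]_2}, independent n X ->
     (#|` X| <= 2 * n + n./2 + 1)%N ->
     forall A : 'rV[R]_2, A \in X ->
       exists p : {mpoly R[2]},
         fundamental n X A p /\ product_of_lines_and_conics p)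
  /\
  (forall n : nat, (3 <= n)%N ->
   forall s : nat, (2 * n + n./2 + 2 <= s <= 'C(n + 2, 2))%N ->
     exists X : {fset 'rV[R]_2},
       [/\ independent n X, #|` X| = s &
           exists2 A : 'rV[R]_2, A \in X &
             forall p : {mpoly R[2]},
               fundamental n X A p -> ~ product_of_lines_and_conics p]).
Proof.
split=> [n n1 X indX cX A AX|n n3 k hk].
  exact: fundamental_product_exists n1 indX cX _ AX.
exact: fundamental_not_product n3 _ hk.
Qed.
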